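(* Let $q\ge 3$ be an odd prime power and put $A_q=\#\mathcal A$, $D_q=\#\mathcal D$, $G_{5,q}=\#\mathcal G_5$, $G_{6,q}=\#\mathcal G_6$, where $\mathcal A$ is the set of admissible ordered triples of monic quadratics over $\mathbb F_q$ and $\mathcal D,\mathcal G_5,\mathcal G_6\subseteq\mathcal A$ are its three strata. Then $$A_q=q(q-1)(q-2)^2(q^2-q+4),$$ $$D_q=q(q-1)(q-2)(q^2-3q+3),$$ $$G_{5,q}=3q(q-1)(q^3-6q^2+14q-13),$$ $$G_{6,q}=A_q-D_q-G_{5,q}=q(q-1)(q^4-9q^3+35q^2-71q+61).$$
   Context: For monic quadratics $u=x^2+u_1x+u_0$, $v=x^2+v_1x+v_0$, $w=x^2+w_1x+w_0$ in $\mathbb F_q[x]$ put $$\mathfrak d(u,v,w)=\det\begin{pmatrix} u_0 & u_1 & 1 \\ v_0 & v_1 & 1 \\ w_0 & w_1 & 1 \end{pmatrix}.$$ $\mathcal A$ is the set of ordered triples $(u,v,w)$ of monic quadratics over $\mathbb F_q$ such that $\operatorname{Disc}(u)\operatorname{Disc}(v)\operatorname{Disc}(w)\operatorname{Res}(u,v)\operatorname{Res}(v,w)\operatorname{Res}(w,u)\ne0$ (equivalently $uvw$ is square-free of degree six). $\mathcal D=\{(u,v,w)\in\mathcal A:\mathfrak d(u,v,w)=0\}$. $\mathcal G_5$ is the set of $(u,v,w)\in\mathcal A$ with $\mathfrak d(u,v,w)\neq0$ and at least one of the equalities $u_1=v_1$, $v_1=w_1$, $w_1=u_1$. $\mathcal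 G_6=\mathcal A\setminus(\mathcal D\cup\mathcal G_5)$, i.e. $\mathfrak d\ne0$ and $u_1,v_1,w_1$ pairwise distinct. *)

(* Defs.v *)
From HB Require Import structures.
From mathcomp Require Import all_boot all_order all_algebra.
From mathcomp Require Import qpoly.

Set Implicit Arguments.
Unset Strict Implicit.
Unset Printing Implicit Defensive.

Import Order.TTheory GRing.Theory Num.Theory.
Local Open Scope ring_scope.

(* A quadratic is an element of {poly_3 F}, the finite type of polynomials of
   size at most 3, so that sets of triples of quadratics have a cardinal. *)
Definition quad_triple (F : finFieldType) : finType :=
  ({poly_3 F} * {poly_3 F} * {poly_3 F})%type.

Definition monic_quadratic (F : finFieldType) (u : {poly F}) : bool :=
  (u \is monic) && (size u == 3%N).

(* Meaningful for quadratics only. *)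
Definition disc2 (F : finFieldType) (u : {poly F}) : F :=
  u`_1 ^+ 2 - 4%:R * u`_2 * u`_0.

Definition quad_det (F : finFieldType) (u v w : {poly F}) : F :=
  \det (\matrix_(i < 3, j < 3)
          (nth [::] [:: [:: u`_0; u`_1; 1];
                        [:: v`_0; v`_1; 1];
                        [:: w`_0; w`_1; 1]] i)`_j).

Definition admissible (F : finFieldType) : {set quad_triple F} :=
  [set t : quad_triple F |
    let: (u, v, w) := t in
    [&& monic_quadratic u, monic_quadratic v, monic_quadratic w &
        disc2 u * disc2 v * disc2 w *
        resultant u v * resultant v w * resultant w u != 0]].

Definition stratumD (F : finFieldType) : {set quad_triple F} :=
  [set t in admissible F | let: (u, v, w) := t in quad_det u v w == 0].

Definition stratumG5 (F : finFieldType) : {set quad_triple F} :=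
  [set t in admissible F |
    let: (u, v, w) := t in
    (quad_det u v w != 0) &&
    [|| (u : {poly F})`_1 == (v : {poly F})`_1,
        (v : {poly F})`_1 == (w : {poly F})`_1 |
        (w : {poly F})`_1 == (u : {poly F})`_1]].

Definition stratumG6 (F : finFieldType) : {set quad_triple F} :=
  admissible F :\: (stratumD F :|: stratumG5 F).

(* Main.v *)
Require Import Defs.
From mathcomp Require Import all_boot all_order all_algebra all_field qpoly.
From mathcomp Require Import ring.

Set Implicit Arguments.
Unset Strict Implicit.
Unset Printing Implicit Defensive.

Import Order.TTheory GRing.Theory Num.Theory.
Local Open Scope ring_scope.

(** A monic quadratic x^2 + a x + b is encoded by the point (a, b) of the
    affine plane.  The points with a double root form a conic (a parabola, as
    4 is invertible), the quadratics vanishing at x form the tangent line of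
    the conic attached to x, and two square-free quadratics have zero
    resultant exactly when they are equal or lie on a common tangent.  The
    theorem counts triples of points off the conic, no two of them equal or
    on a common tangent.

    All triples.  Write r(u), which is 0 or 2, for the number of roots of u in
    the field.  Up to a diagonal correction, the indicator of u and w not
    being coprime is the number of their common roots (not_separatedE).
    Summing over w and exchanging sums leaves only the number of points on one
    tangent, q - 1, or on two, 1 (pencil1, pencil2).  Hence a coprime pair
    (u, v) extends to
      q (q - 1) - 2 - (q - 2) (r(u) + r(v)) + r(u) r(v)
    triples (sum_separated2), and summing over v and u only needs
    r(u)^2 = 2 r(u) and the fact that r has sum q (q - 1).

    Collinear triples.  Two points of a tangent are never coprime, while two
    points of any other line always are.  So these triples are the ordered
    triples of distinct points of a non-tangent line, off the conic.  A
    vertical line has q - 1 points off the conic.  A line of the form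
    4 b = - (p1 a + p0) is the polar of p = x^2 + p1 x + p0: its point of
    abscissa a has discriminant p(a), and it is tangent exactly when p has a
    double root.  It thus has q - r(p) points off the conic, and the sum over
    lines is again a sum over square-free quadratics.

    Triples with two equal linear coefficients.  If u and v lie on a vertical
    line, then noncollinearity of (u, v, w) says that w is off that line, so
    exactly one pair of linear coefficients agrees and, by cyclic symmetry,
    one counts the case of u and v and multiplies by 3.  The number of w is
    the one above minus the q - 3 remaining points of the line
    (sum_separated2_off_fiber). *)

(** * Sums of indicators *)

Lemma sum_pred1 (T : finType) (P : pred T) (a : T) (f : T -> int) :
  P =1 pred1 a -> \sum_(i | P i) f i = f a.
Proof. by move=> Pa; rewrite (eq_bigl _ _ Pa) big_pred1_eq. Qed.

Lemma sum_mulb (T : finType) (P b : pred T) (f : T -> int) :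
  \sum_(i | P i) f i * (b i)%:R = \sum_(i | P i && b i) f i.
Proof.
rewrite big_mkcondr; apply: eq_bigr => i _.
by case: (b i); rewrite ?mulr1 ?mulr0.
Qed.

Lemma sum_indicator (T : finType) (P b : pred T) :
  \sum_(i | P i) (b i)%:R = \sum_(i | P i && b i) (1 : int).
Proof.
by rewrite big_mkcondr; apply: eq_bigr => i _; case: (b i).
Qed.

Lemma cardZ_sum (T : finType) (A : {pred T}) :
  #|A|%:Z = \sum_(i in A) (1 : int).
Proof. by rewrite sumr_const natz. Qed.

Lemma sum_neq1 (T : finType) (a : T) :
  \sum_(i | i != a) (1 : int) = #|T|%:Z - 1.
Proof.
rewrite sumr_const -[X in _ = X - 1]natz.
by rewrite (cardD1 a T) inE /= add1n -[_.+1]addn1 natrD addrK; congr (_ *+ _);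
   apply: eq_card => i; rewrite !inE andbT.
Qed.

Lemma sum_eqM (T : finType) (P : pred T) (u : T) (c : int) (f : T -> int) :
  P u -> \sum_(w | P w) (u == w)%:R * c * f w = c * f u.
Proof.
move=> Pu; rewrite (bigD1 u) //= eqxx mul1r big1 ?addr0 // => w /andP[_ wu].
by rewrite eq_sym (negPf wu) !mul0r.
Qed.

Lemma sum_triple (A B C : finType) (P : pred A) (Q : A -> pred B)
    (R : A -> B -> pred C) (f : A * B * C -> int) :
  \sum_(t : A * B * C | [&& P t.1.1, Q t.1.1 t.1.2 & R t.1.1 t.1.2 t.2]) f t =
  \sum_(a | P a) \sum_(b | Q a b) \sum_(c | R a b c) f (a, b, c).
Proof.
rewrite (pair_big_dep P Q (fun a b => \sum_(c | R a b c) f (a, b, c))) /=.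
rewrite (pair_big_dep (fun s => P s.1 && Q s.1 s.2) (fun s => R s.1 s.2)
           (fun s c => f (s.1, s.2, c))) /=.
by apply: eq_big => [[[a b] c]|[[a b] c] _] //=; rewrite andbA.
Qed.

Definition distinct_triples (T : finType) (S : pred T) : {set T * T * T} :=
  [set t | [&& S t.1.1, (S t.1.2) && (t.1.2 != t.1.1)
             & [&& S t.2, t.2 != t.1.1 & t.2 != t.1.2]]].

Lemma card_distinct_triples (T : finType) (S : pred T) (n : int) :
  \sum_(x | S x) (1 : int) = n ->
  #|distinct_triples S|%:Z = n * (n - 1) * (n - 2).
Proof.
move=> Sn; rewrite cardZ_sum.
under eq_bigl do rewrite inE.
rewrite (sum_triple S (fun x y => S y && (y != x))
          (fun x y z => [&& S z, z != x & z != y])) /=.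
have n1 x : S x -> \sum_(y | S y && (y != x)) (1 : int) = n - 1.
  by move=> Sx; rewrite -Sn (bigD1 x Sx) /= addrC addrK.
have n2 x y : S x -> S y && (y != x) ->
    \sum_(z | [&& S z, z != x & z != y]) (1 : int) = n - 2.
  move=> Sx Sy; have := n1 x Sx; rewrite (bigD1 y Sy) /=.
  under eq_bigl do rewrite -andbA.
  by move=> E; apply: (addrI 1); rewrite E; ring.
transitivity (\sum_(x | S x) (1 * ((n - 1) * (n - 2)))); last first.
  by rewrite -mulr_suml Sn mulrA.
apply: eq_bigr => x Sx; under eq_bigr => y Sy do rewrite n2 // -[n - 2]mul1r.
by rewrite -mulr_suml n1 // mul1r.
Qed.

(** * Quadratics as points of the plane *)

Definition vanishes (F : finFieldType) (p : F * F) (x : F) : bool :=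
  x ^+ 2 + p.1 * x + p.2 == 0.

Definition sqfree (F : finFieldType) (p : F * F) : bool :=
  p.1 ^+ 2 - 4%:R * p.2 != 0.

Definition separated (F : finFieldType) (p q : F * F) : bool :=
  (p != q) && [forall x, ~~ (vanishes p x && vanishes q x)].

Definition with_roots (F : finFieldType) (x y : F) : F * F :=
  (- (x + y), x * y).

(** Integer-valued, since the counts below involve subtractions. *)
Definition nroots (F : finFieldType) (p : F * F) : int :=
  \sum_x (vanishes p x)%:R.

Definition ncommon (F : finFieldType) (p q : F * F) : int :=
  \sum_x (vanishes p x)%:R * (vanishes q x)%:R.

(** In characteristic 2 the field is a vector space over its prime field of
    two elements, so its cardinal is a power of 2. *)
Lemma odd_card_neq0 (F : finFieldType) : odd #|F| -> (2%:R : F) != 0.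
Proof.
move=> oddF; apply/negP => F2.
have ch2 : 2%N \in [pchar F] by rewrite inE.
have cardF := card_pprimeChar ch2.
have : odd #|F| by [].
rewrite -[#|F|]/(#|pPrimeCharType ch2|) cardF oddX orbF => /eqP l0.
by have := finNzRing_gt1 F; rewrite -[#|F|]/(#|pPrimeCharType ch2|) cardF l0.
Qed.

Lemma separated_neq (F : finFieldType) (u v : F * F) : separated u v -> u != v.
Proof. by case/andP. Qed.

Lemma vanishes_with_roots (F : finFieldType) (x y z : F) :
  vanishes (with_roots x y) z = (z == x) || (z == y).
Proof.
rewrite /vanishes /= -(subr_eq0 z x) -(subr_eq0 z y) -mulf_eq0.
by congr (_ == 0); ring.
Qed.

(** By Vieta, a root x forces the second root - p.1 - x to lie in the field. *)
Lemma vanishes_with_rootsE (F : finFieldType) (p : F * F) (x : F) :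
  vanishes p x = (p == with_roots x (- p.1 - x)).
Proof.
case: p => a b; rewrite /vanishes /with_roots xpair_eqE /=.
have -> : - (x + (- a - x)) = a by ring.
by rewrite eqxx andTb -[RHS]subr_eq0; congr (_ == 0); ring.
Qed.

Lemma sqfree_with_roots (F : finFieldType) (x y : F) :
  sqfree (with_roots x y) = (x != y).
Proof.
rewrite /sqfree /= -(subr_eq0 x y) -[in RHS](sqrf_eq0 (x - y)).
by congr (_ != 0); ring.
Qed.

Lemma vanishes2 (F : finFieldType) (p : F * F) (x y : F) : x != y ->
  vanishes p x && vanishes p y = (p == with_roots x y).
Proof.
move=> xy; apply/andP/eqP => [[px py]| ->]; last first.
  by rewrite !vanishes_with_roots !eqxx orbT.
move: px py; rewrite vanishes_with_rootsE => /eqP ->.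
by rewrite vanishes_with_roots eq_sym (negPf xy) => /eqP <-.
Qed.

Lemma nroots_with_roots (F : finFieldType) (x y : F) :
  x != y -> nroots (with_roots x y) = 2.
Proof.
move=> xy; rewrite /nroots (bigD1 x) //= (bigD1 y) 1?eq_sym //= big1.
  by rewrite !vanishes_with_roots !eqxx orbT.
by move=> z /andP[zx zy]; rewrite vanishes_with_roots (negPf zx) (negPf zy).
Qed.

Lemma nroots0 (F : finFieldType) (p : F * F) :
  (forall x, ~~ vanishes p x) -> nroots p = 0.
Proof.
by move=> p0; rewrite /nroots big1 // => x _; rewrite (negPf (p0 x)).
Qed.

Lemma nroots_sqfree (F : finFieldType) (p : F * F) :
  sqfree p -> nroots p = 0 \/ nroots p = 2.
Proof.
move=> sfp; have [/existsP[x]|/existsPn p0] := boolP [exists x, vanishes p x].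
  rewrite vanishes_with_rootsE => /eqP pE; right.
  by move: sfp; rewrite pE sqfree_with_roots => /nroots_with_roots.
by left; apply: nroots0.
Qed.

(** As r takes only the values 0 and 2, every polynomial in r reduces to an
    affine one; this is how the sums over all quadratics get evaluated. *)
Lemma nroots_sqr (F : finFieldType) (p : F * F) :
  sqfree p -> nroots p ^+ 2 = 2 * nroots p.
Proof. by case/nroots_sqfree => ->. Qed.

(** Each square-free quadratic vanishing at x is determined by its other root,
    which is any element different from x. *)
Lemma pencil1 (F : finFieldType) (x : F) :
  \sum_(w | sqfree w) (vanishes w x)%:R = #|F|%:Z - 1.
Proof.
rewrite sum_indicator -(sum_neq1 x).
rewrite (reindex_onto (with_roots x) (fun w => - w.1 - x)) /=.
  apply: eq_bigl => y; rewrite sqfree_with_roots vanishes_with_roots eqxx.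
  rewrite eq_sym /= andbT; have -> : - - (x + y) - x = y by ring.
  by rewrite eqxx andbT.
by move=> w /andP[_]; rewrite vanishes_with_rootsE => /eqP.
Qed.

Lemma pencil2 (F : finFieldType) (x y : F) : x != y ->
  \sum_(w | sqfree w) (vanishes w x)%:R * (vanishes w y)%:R = 1 :> int.
Proof.
move=> xy; under eq_bigr do rewrite -natrM mulnb.
rewrite sum_indicator (@sum_pred1 _ _ (with_roots x y)) // => w /=.
by rewrite vanishes2 // andbC; case: eqP => //= ->; rewrite sqfree_with_roots.
Qed.

Lemma pencil12 (F : finFieldType) (x y : F) :
  \sum_(w | sqfree w) (vanishes w x)%:R * (vanishes w y)%:R
    = 1 + (x == y)%:R * (#|F|%:Z - 2) :> int.
Proof.
case: eqVneq => [-> | /pencil2 ->]; last by rewrite mul0r addr0.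
under eq_bigr do rewrite -natrM mulnb andbb.
by rewrite pencil1 mul1r; ring.
Qed.

Lemma sum_nroots (F : finFieldType) :
  \sum_(w : F * F | sqfree w) nroots w = #|F|%:Z * (#|F|%:Z - 1).
Proof.
rewrite exchange_big /=; under eq_bigr do rewrite pencil1.
by rewrite sumr_const -mulr_natl natz.
Qed.

Lemma sum_sqfree_fiber (F : finFieldType) (a : F) : (2%:R : F) != 0 ->
  \sum_(b | sqfree (a, b)) (1 : int) = #|F|%:Z - 1.
Proof.
move=> F2; have F4 : (4%:R : F) != 0 by rewrite (natrM _ 2 2) mulf_neq0.
rewrite -(sum_neq1 (a ^+ 2 / 4%:R)); apply: eq_bigl => b.
suff eb : (a ^+ 2 == 4%:R * b) = (b == a ^+ 2 / 4%:R).
  by rewrite /sqfree /= subr_eq0 eb.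
apply/eqP/eqP => [-> | ->]; first by rewrite (mulrC 4%:R) mulfK.
by rewrite mulrC divfK.
Qed.

Lemma sum_sqfree (F : finFieldType) : (2%:R : F) != 0 ->
  \sum_(w : F * F | sqfree w) (1 : int) = #|F|%:Z * (#|F|%:Z - 1).
Proof.
move=> F2.
rewrite -(pair_big_dep predT (fun a b => sqfree (a, b)) (fun _ _ => 1)) /=.
under eq_bigr do rewrite sum_sqfree_fiber //.
by rewrite sumr_const -mulr_natl natz.
Qed.

(** * Counting quadratics coprime to given ones *)

Lemma separatedC (F : finFieldType) (u v : F * F) :
  separated u v = separated v u.
Proof.
rewrite /separated eq_sym; congr (_ && _).
by apply: eq_forallb => x; rewrite andbC.
Qed.

Lemma ncommon_separated (F : finFieldType) (u v : F * F) :
  separated u v -> ncommon u v = 0.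
Proof.
case/andP=> _ /forallP uv; rewrite /ncommon big1 // => x _.
by rewrite -natrM mulnb (negPf (uv x)).
Qed.

(** Distinct quadratics share at most one root, so ncommon is already the
    indicator off the diagonal; the second term corrects the diagonal, where
    ncommon counts all the roots of u. *)
Lemma not_separatedE (F : finFieldType) (u w : F * F) :
  (~~ separated u w)%:R = ncommon u w - (u == w)%:R * (nroots u - 1).
Proof.
have [/[dup] uw /ncommon_separated ->|] := boolP (separated u w).
  by case/andP: uw => /negPf ->; rewrite mul0r subr0.
rewrite negb_and negbK; have [-> _|uw /= ] := eqVneq u w.
  have -> : ncommon w w = nroots w.
    by apply: eq_bigr => x _; rewrite -natrM mulnb andbb.
  by rewrite mul1r subKr.
rewrite negb_forall => /existsP[x]; rewrite negbK => /andP[ux wx].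
rewrite mul0r subr0 /ncommon (bigD1 x) //= ux wx big1 ?addr0 // => y yx.
rewrite -natrM mulnb; case: andP => // -[uy wy].
move: (vanishes2 u yx) (vanishes2 w yx); rewrite ux uy wx wy /=.
by move=> /esym/eqP uE /esym/eqP wE; rewrite uE wE eqxx in uw.
Qed.

Lemma sum_ncommonM (F : finFieldType) (P : pred (F * F)) (u : F * F)
    (f : F * F -> int) :
  \sum_(w | P w) ncommon u w * f w =
  \sum_x (vanishes u x)%:R * \sum_(w | P w) (vanishes w x)%:R * f w.
Proof.
under eq_bigr do rewrite mulr_suml.
rewrite exchange_big /=; apply: eq_bigr => x _; rewrite mulr_sumr.
by apply: eq_bigr => w _; rewrite mulrA.
Qed.

(** Weighted count of the quadratics that are not coprime to u, reduced to sums
    over the pencils of quadratics through each root of u. *)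
Lemma sum_not_separatedM (F : finFieldType) (u : F * F) (f : F * F -> int) :
  sqfree u ->
  \sum_(w | sqfree w) (~~ separated u w)%:R * f w =
  \sum_x (vanishes u x)%:R * (\sum_(w | sqfree w) (vanishes w x)%:R * f w)
    - (nroots u - 1) * f u.
Proof.
move=> sfu; under eq_bigr do rewrite not_separatedE mulrBl.
by rewrite sumrB sum_ncommonM sum_eqM.
Qed.

Lemma sum_not_separated (F : finFieldType) (u : F * F) : sqfree u ->
  \sum_(w | sqfree w) (~~ separated u w)%:R = 1 + (#|F|%:Z - 2) * nroots u.
Proof.
move=> sfu; have := sum_not_separatedM (fun=> 1) sfu.
under eq_bigr do rewrite mulr1; move=> ->.
under eq_bigr do under eq_bigr do rewrite mulr1.
under eq_bigr do rewrite pencil1.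
by rewrite -mulr_suml -/(nroots u); ring.
Qed.

Lemma pencil_nroots (F : finFieldType) (x : F) :
  \sum_(w | sqfree w) (vanishes w x)%:R * nroots w = 2 * #|F|%:Z - 2.
Proof.
under eq_bigr do rewrite mulr_sumr.
rewrite exchange_big /=; under eq_bigr do rewrite pencil12.
rewrite big_split /= -mulr_suml sumr_const (natz #|_|).
rewrite (bigD1 x) //= eqxx big1 ?addr0; last first.
  by move=> y /negPf yx; rewrite eq_sym yx.
by rewrite mul1r; ring.
Qed.

Lemma sum_not_separated_nroots (F : finFieldType) (u : F * F) : sqfree u ->
  \sum_(w | sqfree w) (~~ separated u w)%:R * nroots w
    = (2 * #|F|%:Z - 3) * nroots u.
Proof.
move=> sfu; rewrite sum_not_separatedM //.
under eq_bigr do rewrite pencil_nroots.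
rewrite -mulr_suml -/(nroots u) mulrBl mul1r -expr2 nroots_sqr //.
by ring.
Qed.

(** A quadratic equal to u is coprime to v, and conversely, so the ones counted
    share a root x with u and a root y with v.  As u and v are coprime, x and y
    differ, and only the quadratic with roots x and y qualifies. *)
Lemma sum_not_separated2 (F : finFieldType) (u v : F * F) :
  sqfree u -> sqfree v -> separated u v ->
  \sum_(w | sqfree w) (~~ separated u w)%:R * (~~ separated v w)%:R
    = nroots u * nroots v.
Proof.
move=> sfu sfv uv; rewrite sum_not_separatedM //.
rewrite separatedC uv mulr0 subr0 mulr_suml; apply: eq_bigr => x _.
have [ux|] := boolP (vanishes u x); last by rewrite !mul0r.
under eq_bigr do rewrite mulrC.
have vx : vanishes v x = false.
  by case/andP: uv => _ /forallP/(_ x); rewrite ux => /negPf.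
rewrite sum_not_separatedM // vx mulr0 subr0.
congr (_ * _); apply: eq_bigr => y _.
have [vy|] := boolP (vanishes v y); last by rewrite mul0r.
rewrite pencil2 ?mulr1 //; apply: contraTneq uv => yx.
by rewrite negb_and negb_forall; apply/orP; right; apply/existsP; exists x;
   rewrite ux -yx vy.
Qed.

(** Inclusion-exclusion on the two coprimality conditions. *)
Lemma sum_separated2 (F : finFieldType) (u v : F * F) : (2%:R : F) != 0 ->
  sqfree u -> sqfree v -> separated u v ->
  \sum_(w | [&& sqfree w, separated u w & separated v w]) (1 : int) =
  #|F|%:Z * (#|F|%:Z - 1) - 2 - (#|F|%:Z - 2) * (nroots u + nroots v)
    + nroots u * nroots v.
Proof.
move=> F2 sfu sfv uv; rewrite -sum_indicator.
under eq_bigr => w _.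
  have -> : (separated u w && separated v w)%:R =
    (1 - (~~ separated u w)%:R - (~~ separated v w)%:R
       + (~~ separated u w)%:R * (~~ separated v w)%:R) :> int.
    by case: separated; case: separated.
  over.
rewrite big_split /= !sumrB sum_sqfree // !sum_not_separated //.
by rewrite sum_not_separated2 //; ring.
Qed.

Lemma count_admissible (F : finFieldType) : (2%:R : F) != 0 ->
  \sum_(u : F * F | sqfree u) \sum_(v | sqfree v && separated u v)
    \sum_(w | [&& sqfree w, separated u w & separated v w]) (1 : int) =
  #|F|%:Z * (#|F|%:Z - 1) * (#|F|%:Z - 2) ^+ 2
    * (#|F|%:Z ^+ 2 - #|F|%:Z + 4).
Proof.
move=> F2; set q := #|F|%:Z.
pose c (u : F * F) : int := q * (q - 1) - 2 - (q - 2) * nroots u.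
pose d (u : F * F) : int := nroots u - (q - 2).
(* The sum over v is affine in the number of roots of u, with coefficients
   k0 and k1 once r^2 is replaced by 2 r. *)
pose k0 : int :=
  (q * (q - 1) - 2) * (q * (q - 1) - 1) - (q - 2) * (q * (q - 1)).
pose k1 : int := - (q - 2) * (2 * q ^+ 2 - 2 * q - 3) + q * (q - 1)
  + (q - 2) * (2 * q - 3) + 2 * ((q - 2) ^+ 2 - (2 * q - 3)).
transitivity (\sum_(u : F * F | sqfree u)
  (k0 + k1 * nroots u)).
  apply: eq_bigr => u sfu.
  under eq_bigr => v /andP[sfv uv].
    rewrite sum_separated2 // -/q.
    have -> : q * (q - 1) - 2 - (q - 2) * (nroots u + nroots v)
       + nroots u * nroots v = c u + d u * nroots v by rewrite /c /d; ring.
    over.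
  rewrite -sum_mulb; under eq_bigr => v _.
    have -> : (c u + d u * nroots v) * (separated u v)%:R =
       c u * 1 - c u * (~~ separated u v)%:R + d u * nroots v
         - d u * ((~~ separated u v)%:R * nroots v).
      by case: separated => /=; ring.
    over.
  rewrite sumrB big_split /= sumrB -!mulr_sumr sum_not_separated_nroots //.
  rewrite sum_not_separated // sum_nroots sum_sqfree // -/q /c /d.
  (* The two sides differ by the multiple of r^2 - 2 r written here. *)
  have /eqP := nroots_sqr sfu; rewrite -subr_eq0 => /eqP rr.
  apply/eqP; rewrite -subr_eq0 -(mulr0 ((q - 2) ^+ 2 - (2 * q - 3))) -rr.
  by apply/eqP; rewrite /k0 /k1; ring.
under eq_bigr do rewrite -[k0]mulr1.
rewrite big_split /= -!mulr_sumr sum_sqfree // sum_nroots -/q /k0 /k1.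
by ring.
Qed.

(** * Quadratics with equal linear coefficients *)

Lemma sum_fiber (F : finFieldType) (a : F) (P : pred (F * F))
    (f : F * F -> int) :
  \sum_(w | P w && (w.1 == a)) f w = \sum_(b | P (a, b)) f (a, b).
Proof.
rewrite (reindex_onto (pair a) (@snd F F)) /=; last first.
  by move=> [x y] /andP[_ /eqP /= ->].
by apply: eq_bigl => b; rewrite !eqxx !andbT.
Qed.

(** On the vertical line of abscissa a, every x is the root of exactly one
    quadratic, with other root - a - x; only x = - a / 2 gives a double root. *)
Lemma sum_nroots_fiber (F : finFieldType) (a : F) : (2%:R : F) != 0 ->
  \sum_(w | sqfree w && (w.1 == a)) nroots w = #|F|%:Z - 1.
Proof.
move=> F2; rewrite exchange_big -(sum_neq1 (- a / 2%:R)) /= [RHS]big_mkcond.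
apply: eq_bigr => x _; rewrite sum_indicator.
have xE : (x == - a / 2%:R) = (x == - a - x).
  apply/eqP/eqP => [-> | xE]; first by field.
  by apply: (mulIf F2); rewrite divfK // mulr_natr mulr2n {1}xE; ring.
case: ifPn; rewrite xE => xa.
  rewrite (@sum_pred1 _ _ (with_roots x (- a - x))) // => w /=.
  apply/andP/eqP => [[/andP[_ /eqP <-]]|->].
    by rewrite vanishes_with_rootsE => /eqP.
  rewrite sqfree_with_roots xa vanishes_with_roots eqxx /=; split=> //.
  by apply/eqP; ring.
rewrite big_pred0 // => w; apply: contraNF xa => /andP[/andP[sfw /eqP wa]].
rewrite vanishes_with_rootsE wa => /eqP wE; move: sfw.
by rewrite wE sqfree_with_roots => ->.
Qed.

(** The second root is determined by a and the first one, so a common root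
    forces equality: vertical lines are not tangent to the conic. *)
Lemma separated_fiber (F : finFieldType) (u v : F * F) :
  u.1 = v.1 -> separated u v = (u != v).
Proof.
move=> uv1; rewrite /separated; case: eqVneq => //= uv.
apply/forallP => x; apply: contra uv; rewrite !vanishes_with_rootsE uv1.
by case/andP=> /eqP-> /eqP<-.
Qed.

(** The vertical line of u and v carries q - 1 square-free quadratics, and all
    of them except u and v are coprime to both, so q - 3 is subtracted from the
    unrestricted count. *)
Lemma sum_separated2_off_fiber (F : finFieldType) (u v : F * F) :
  (2%:R : F) != 0 -> sqfree u -> sqfree v -> u != v -> v.1 = u.1 ->
  \sum_(w | [&& sqfree w, separated u w & separated v w] && (w.1 != u.1))
     (1 : int) =
  (#|F|%:Z - 1) ^+ 2 - (#|F|%:Z - 2) * (nroots u + nroots v)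
    + nroots u * nroots v.
Proof.
move=> F2 sfu sfv uv vu1; have sepuv : separated u v by rewrite separated_fiber.
have := sum_separated2 F2 sfu sfv sepuv.
rewrite (bigID (fun w => w.1 == u.1)) /=.
suff -> : \sum_(w | [&& sqfree w, separated u w & separated v w]
            && (w.1 == u.1)) (1 : int) = #|F|%:Z - 3.
  move=> E; apply: (addrI (#|F|%:Z - 3)); rewrite E; ring.
rewrite -[RHS](addrK 2); have -> : #|F|%:Z - 3 + 2 = #|F|%:Z - 1 by ring.
rewrite -(sum_sqfree_fiber u.1 F2) -(sum_fiber u.1 (@sqfree F) (fun=> 1)).
rewrite [in RHS](bigD1 u) ?sfu ?eqxx //= [in RHS](bigD1 v) /=; last first.
  by rewrite sfv vu1 eqxx eq_sym.
rewrite addrA [X in _ = X - 2]addrC addrK; apply: eq_bigl => w.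
have [wu1|] := eqVneq w.1 u.1; last by rewrite !andbF.
rewrite !separated_fiber // ?vu1 // !andbT -andbA.
by rewrite ![w == _]eq_sym.
Qed.

Lemma count_fiber_pairs (F : finFieldType) : (2%:R : F) != 0 ->
  \sum_(u : F * F | sqfree u)
    \sum_(v | [&& sqfree v, v.1 == u.1 & u != v])
    \sum_(w | [&& sqfree w, separated u w & separated v w] && (w.1 != u.1))
      (1 : int) =
  #|F|%:Z * (#|F|%:Z - 1)
    * (#|F|%:Z ^+ 3 - 6 * #|F|%:Z ^+ 2 + 14 * #|F|%:Z - 13).
Proof.
move=> F2; set q := #|F|%:Z.
pose c (u : F * F) : int := (q - 1) ^+ 2 - (q - 2) * nroots u.
pose d (u : F * F) : int := nroots u - (q - 2).
(* As above, k0 + k1 r is the value of the sum over v. *)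
pose k0 : int := (q - 1) ^+ 2 * (q - 2) - (q - 2) * (q - 1).
pose k1 : int := - (q - 2) * (q - 2) + (q - 1) + (q - 2) - 2.
transitivity (\sum_(u : F * F | sqfree u) (k0 * 1 + k1 * nroots u)).
  apply: eq_bigr => u sfu.
  under eq_bigr => v /and3P[sfv /eqP vu1 uv].
    rewrite sum_separated2_off_fiber // -/q.
    have -> : (q - 1) ^+ 2 - (q - 2) * (nroots u + nroots v)
       + nroots u * nroots v = c u * 1 + d u * nroots v by rewrite /c /d; ring.
    over.
  have fib (f : F * F -> int) :
      \sum_(v | [&& sqfree v, v.1 == u.1 & u != v]) f v
      = \sum_(v | sqfree v && (v.1 == u.1)) f v - f u.
    rewrite [in RHS](bigD1 u) ?sfu ?eqxx //= addrC addrK.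
    by apply: eq_bigl => v; rewrite -andbA [v == u]eq_sym.
  rewrite big_split /= -!mulr_sumr !fib sum_nroots_fiber //.
  rewrite sum_fiber sum_sqfree_fiber // -/q /c /d.
  (* The two sides differ by - (r^2 - 2 r). *)
  have /eqP := nroots_sqr sfu; rewrite -subr_eq0 => /eqP rr.
  apply/eqP; rewrite -subr_eq0 -[X in _ == X]oppr0 -rr.
  by apply/eqP; rewrite /k0 /k1; ring.
rewrite big_split /= -!mulr_sumr sum_sqfree // sum_nroots -/q /k0 /k1.
by ring.
Qed.

(** * Collinear triples *)

Definition collinear (F : finFieldType) (u v w : F * F) : bool :=
  (v.1 - u.1) * (w.2 - u.2) == (w.1 - u.1) * (v.2 - u.2).

Definition separated_triple (F : finFieldType) (u v w : F * F) : bool :=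
  [&& sqfree u, sqfree v && separated u v
    & [&& sqfree w, separated u w & separated v w]].

(** The point of abscissa a on the line 4 b = - (p.1 a + p.2), the polar of p
    with respect to the conic of double roots. *)
Definition polar_point (F : finFieldType) (p : F * F) (a : F) : F * F :=
  (a, - (p.1 * a + p.2) / 4%:R).

Definition triple_of (A B : Type) (f : A -> B) (t : A * A * A) : B * B * B :=
  (f t.1.1, f t.1.2, f t.2).

(** The discriminant of the point of abscissa a is the value p(a). *)
Lemma sqfree_polar_point (F : finFieldType) (p : F * F) (a : F) :
  (4%:R : F) != 0 -> sqfree (polar_point p a) = ~~ vanishes p a.
Proof.
by move=> F4; rewrite /sqfree /vanishes mulrC divfK //= opprK addrA.
Qed.

(** The polar of p is tangent exactly when p lies on the conic.  Algebraically,
    if the quadratics at x and y share the root r then an affine function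
    vanishes at both x and y, and its two zero coefficients say that p(z) is
    (z + 2 r)^2. *)
Lemma separated_polar_points (F : finFieldType) (p : F * F) (x y : F) :
  (4%:R : F) != 0 -> x != y ->
  separated (polar_point p x) (polar_point p y) = sqfree p.
Proof.
move=> F4 xy; rewrite /separated (_ : _ != _ = true) /=; last first.
  by rewrite xpair_eqE (negPf xy).
have vE a r : vanishes (polar_point p a) r
    = (4%:R * r ^+ 2 - p.2 == (p.1 - 4%:R * r) * a).
  rewrite /vanishes /= -(inj_eq (mulfI F4)) mulr0 -[in RHS]subr_eq0.
  by congr (_ == 0); field.
apply/forallP/idP => [sep|sfp r].
  apply/negP => /eqP dp; have := sep (p.1 / 4%:R); rewrite !vE.
  have -> : p.1 - 4%:R * (p.1 / 4%:R) = 0 by field.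
  have -> : 4%:R * (p.1 / 4%:R) ^+ 2 - p.2 = (p.1 ^+ 2 - 4%:R * p.2) / 4%:R.
    by field.
  by rewrite dp !mul0r eqxx.
apply: contra sfp; rewrite !vE => /andP[/eqP Ex /eqP Ey].
have r4 : p.1 = 4%:R * r.
  apply/eqP; rewrite -subr_eq0; move: (Ex); rewrite Ey.
  move=> /esym/eqP; rewrite -subr_eq0 -mulrBr mulf_eq0 (subr_eq0 x).
  by rewrite (negPf xy) orbF.
move: Ex; rewrite r4 subrr mul0r => /eqP; rewrite subr_eq0 => /eqP <-.
by apply/eqP; ring.
Qed.

(** The p whose polar is the line through u and v, when that line is not
    vertical. *)
Definition line_through (F : finFieldType) (u v : F * F) : F * F :=
  let m := - 4%:R * (v.2 - u.2) / (v.1 - u.1) in (m, - 4%:R * u.2 - m * u.1).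

Lemma line_through_polar_points (F : finFieldType) (p : F * F) (x y : F) :
  (4%:R : F) != 0 -> x != y ->
  line_through (polar_point p x) (polar_point p y) = p.
Proof.
move=> F4; rewrite eq_sym -subr_eq0 => yx; case: p => m c.
have mE : - 4%:R * (- (m * y + c) / 4%:R - - (m * x + c) / 4%:R) / (y - x) = m.
  by field; rewrite yx F4.
by rewrite /line_through /= mE; congr (_, _); field.
Qed.

Lemma polar_point_line_through (F : finFieldType) (u v w : F * F) :
  (4%:R : F) != 0 -> u.1 != v.1 -> collinear u v w ->
  polar_point (line_through u v) w.1 = w.
Proof.
move=> F4; rewrite eq_sym -subr_eq0 => vu /eqP uvw.
rewrite [RHS]surjective_pairing /polar_point /line_through /=; congr (_, _).
apply: (mulfI vu).
transitivity ((v.1 - u.1) * u.2 + (w.1 - u.1) * (v.2 - u.2)).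
  by field; rewrite vu F4.
by rewrite -uvw; ring.
Qed.

Lemma collinear_polar_points (F : finFieldType) (p : F * F) (x y z : F) :
  (4%:R : F) != 0 ->
  collinear (polar_point p x) (polar_point p y) (polar_point p z).
Proof. by move=> F4; apply/eqP => /=; field. Qed.

Definition point_triple (F : finFieldType) : finType :=
  (F * F * (F * F) * (F * F))%type.

Definition collinear_triples (F : finFieldType) : {set point_triple F} :=
  [set t | separated_triple t.1.1 t.1.2 t.2 && collinear t.1.1 t.1.2 t.2].

Lemma collinear_fiber (F : finFieldType) (u v w : F * F) :
  u != v -> u.1 = v.1 -> collinear u v w = (w.1 == u.1).
Proof.
move=> uv uv1; rewrite /collinear uv1 subrr mul0r eq_sym mulf_eq0 !subr_eq0.
suff /negPf -> : v.2 != u.2 by rewrite orbF.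
by apply: contraNneq uv => uv2; apply/eqP/eqP;
   rewrite [u]surjective_pairing [v]surjective_pairing uv1 uv2.
Qed.

(** Such a triple is a vertical line with three distinct points of it off the
    conic. *)
Lemma count_vertical_triples (F : finFieldType) : (2%:R : F) != 0 ->
  #|[set t in collinear_triples F | t.1.1.1 == t.1.2.1]|%:Z =
  #|F|%:Z * ((#|F|%:Z - 1) * (#|F|%:Z - 2) * (#|F|%:Z - 3)).
Proof.
move=> F2.
pose S (a : F) := distinct_triples (fun b => sqfree (a, b)).
pose f (s : F * (F * F * F)) := triple_of (pair s.1) s.2.
have -> : [set t in collinear_triples F | t.1.1.1 == t.1.2.1]
    = f @: [set s | s.2 \in S s.1].
  apply/setP => -[[[a x] [a' y]] [a'' z]]; apply/idP/imsetP.
    rewrite !inE /separated_triple /= => /andP[/andP[]].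
    move=> /and3P[sfu /andP[sfv uv] /and3P[sfw uw vw]] + /eqP aa'.
    subst a'; rewrite collinear_fiber ?separated_neq // => /eqP /= a'a.
    subst a''; exists (a, (x, y, z)) => //.
    move: uv uw vw; rewrite !separated_fiber // !xpair_eqE !eqxx /= => xy xz yz.
    by rewrite !inE /= sfu sfv sfw !(eq_sym _ x) xy xz eq_sym yz.
  case=> -[b [[x' y'] z']]; rewrite !inE /=.
  move=> /and3P[sfu /andP[sfv uv] /and3P[sfw uw vw]] [-> -> -> -> -> ->] /=.
  rewrite /separated_triple sfu sfv sfw !separated_fiber // collinear_fiber //=.
    rewrite !xpair_eqE !eqxx /=.
    by move: uv uw vw; rewrite ![z' == _]eq_sym [y' == _]eq_sym => -> -> ->.
  by rewrite xpair_eqE eqxx /= eq_sym.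
rewrite card_imset; last first.
  by move=> [a [[x y] z]] [a' [[x' y'] z']] [-> -> _ -> _ ->].
rewrite cardZ_sum; under eq_bigl do rewrite inE.
rewrite -(pair_big_dep predT (fun a t => t \in S a) (fun _ _ => 1)) /=.
under eq_bigr do
  rewrite -cardZ_sum (card_distinct_triples (sum_sqfree_fiber _ F2)).
by rewrite sumr_const -mulr_natl natz; ring.
Qed.

(** Such a triple is a non-tangent line, given by a square-free p, with three
    distinct abscissas that are not roots of p. *)
Lemma count_oblique_triples (F : finFieldType) : (2%:R : F) != 0 ->
  #|[set t in collinear_triples F | t.1.1.1 != t.1.2.1]|%:Z =
  #|F|%:Z * (#|F|%:Z - 1)
    * ((#|F|%:Z - 2) * (#|F|%:Z ^+ 2 - 4 * #|F|%:Z + 6)).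
Proof.
move=> F2; have F4 : (4%:R : F) != 0 by rewrite (natrM _ 2 2) mulf_neq0.
pose S (p : F * F) := distinct_triples (fun a => ~~ vanishes p a).
pose f (s : F * F * (F * F * F)) := triple_of (polar_point s.1) s.2.
pose g (t : F * F * (F * F) * (F * F)) :=
  (line_through t.1.1 t.1.2, triple_of fst t).
have -> : [set t in collinear_triples F | t.1.1.1 != t.1.2.1]
    = f @: [set s | sqfree s.1 && (s.2 \in S s.1)].
  apply/setP => -[[u v] w]; apply/idP/imsetP.
    rewrite !inE /separated_triple /= => /andP[/andP[]].
    move=> /and3P[sfu /andP[sfv uv] /and3P[sfw uw vw]] uvw uv1.
    set p := line_through u v.
    have wE : polar_point p w.1 = w by apply: polar_point_line_through.
    have uE : polar_point p u.1 = u.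
      apply: polar_point_line_through; rewrite // /collinear.
      by rewrite !subrr mulr0 mul0r.
    have vE : polar_point p v.1 = v.
      by apply: polar_point_line_through; rewrite // /collinear.
    have wu1 : w.1 != u.1.
      by apply: contraNneq (separated_neq uw) => wu1; rewrite -wE wu1 uE.
    have wv1 : w.1 != v.1.
      by apply: contraNneq (separated_neq vw) => wv1; rewrite -wE wv1 vE.
    exists (p, (u.1, v.1, w.1)); last by rewrite /f /triple_of /= uE vE wE.
    rewrite !inE /= -!sqfree_polar_point // uE vE wE sfu sfv sfw wu1 wv1.
    by rewrite eq_sym uv1 -(separated_polar_points p F4 uv1) uE vE uv.
  case=> -[p [[x y] z]]; rewrite !inE /= -!sqfree_polar_point //.
  move=> /andP[sfp /and3P[sfu /andP[sfv uv] /and3P[sfw uw vw]]] [-> -> ->] /=.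
  rewrite /separated_triple sfu sfv sfw collinear_polar_points //.
  by rewrite !separated_polar_points ?sfp // eq_sym.
rewrite (card_in_imset (can_in_inj (g := g) _)); last first.
  move=> [p [[x y] z]]; rewrite !inE => /and3P[_ _ /andP[/andP[_ xy] _]].
  by rewrite /g /f /= line_through_polar_points // eq_sym.
rewrite cardZ_sum; under eq_bigl do rewrite inE.
rewrite -(pair_big_dep (@sqfree F) (fun p t => t \in S p) (fun _ _ => 1)) /=.
set q := #|F|%:Z.
transitivity (\sum_(p : F * F | sqfree p)
    (q * (q - 1) * (q - 2) * 1 + (- 3 * (q - 2) ^+ 2) * nroots p)).
  apply: eq_bigr => p sfp; rewrite -cardZ_sum.
  rewrite (@card_distinct_triples _ _ (q - nroots p)); last first.
    rewrite /q /nroots cardZ_sum sum_indicator.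
    by rewrite [in RHS](bigID (vanishes p)) /= addrC addrK.
  by case: (nroots_sqfree sfp) => ->; ring.
rewrite big_split /= -!mulr_sumr sum_sqfree // sum_nroots -/q.
by ring.
Qed.

Lemma count_collinear (F : finFieldType) : (2%:R : F) != 0 ->
  #|collinear_triples F|%:Z =
  #|F|%:Z * (#|F|%:Z - 1) * (#|F|%:Z - 2) * (#|F|%:Z ^+ 2 - 3 * #|F|%:Z + 3).
Proof.
move=> F2; rewrite -(cardsID [set t | t.1.1.1 == t.1.2.1]) PoszD.
have -> : collinear_triples F :&: [set t | t.1.1.1 == t.1.2.1]
    = [set t in collinear_triples F | t.1.1.1 == t.1.2.1].
  by apply/setP => t; rewrite !inE.
have -> : collinear_triples F :\: [set t | t.1.1.1 == t.1.2.1]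
    = [set t in collinear_triples F | t.1.1.1 != t.1.2.1].
  by apply/setP => t; rewrite !inE andbC.
by rewrite count_vertical_triples // count_oblique_triples //; ring.
Qed.

(** * The three strata as sets of point triples *)

Definition admissible_triples (F : finFieldType) : {set point_triple F} :=
  [set t | separated_triple t.1.1 t.1.2 t.2].

Lemma card_admissible_triples (F : finFieldType) : (2%:R : F) != 0 ->
  #|admissible_triples F|%:Z =
  #|F|%:Z * (#|F|%:Z - 1) * (#|F|%:Z - 2) ^+ 2
    * (#|F|%:Z ^+ 2 - #|F|%:Z + 4).
Proof.
move=> F2; rewrite -(count_admissible F2) cardZ_sum.
under eq_bigl do rewrite inE.
exact: (sum_triple (@sqfree F) (fun u v => sqfree v && separated u v)
  (fun u v w => [&& sqfree w, separated u w & separated v w]) (fun=> 1)).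
Qed.

Definition rotate (T : Type) (t : T * T * T) : T * T * T := (t.1.2, t.2, t.1.1).

Lemma rotateK (T : Type) :
  cancel (@rotate T) (fun t => (t.2, t.1.1, t.1.2)).
Proof. by case=> [[]]. Qed.

Lemma separated_triple_rotate (F : finFieldType) (u v w : F * F) :
  separated_triple v w u = separated_triple u v w.
Proof.
rewrite /separated_triple (separatedC v u) (separatedC w u).
by case: (sqfree u); case: (sqfree v); case: (sqfree w); rewrite ?andbF //=;
   case: separated; case: separated; case: separated.
Qed.

Lemma collinear_rotate (F : finFieldType) (u v w : F * F) :
  collinear v w u = collinear u v w.
Proof.
by rewrite /collinear -[LHS]subr_eq0 -[RHS]subr_eq0; congr (_ == 0); ring.
Qed.

Definition fiber_triples (F : finFieldType) : {set point_triple F} :=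
  [set t | separated_triple t.1.1 t.1.2 t.2
    && (t.1.2.1 == t.1.1.1) && (t.2.1 != t.1.1.1)].

Lemma card_fiber_triples (F : finFieldType) : (2%:R : F) != 0 ->
  #|fiber_triples F|%:Z =
  #|F|%:Z * (#|F|%:Z - 1)
    * (#|F|%:Z ^+ 3 - 6 * #|F|%:Z ^+ 2 + 14 * #|F|%:Z - 13).
Proof.
move=> F2; rewrite -(count_fiber_pairs F2) cardZ_sum.
rewrite -(sum_triple (@sqfree F)
  (fun u v => [&& sqfree v, v.1 == u.1 & u != v])
  (fun u v w => [&& sqfree w, separated u w & separated v w] && (w.1 != u.1))
  (fun=> 1)).
apply: eq_bigl => -[[u v] w]; rewrite inE /separated_triple /=.
case: eqP => [vu1|_]; last by rewrite !andbF.
by rewrite (separated_fiber (esym vu1)) andbT /= -!andbA.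
Qed.

Definition noncollinear_fiber_triples (F : finFieldType) :
    {set point_triple F} :=
  [set t | separated_triple t.1.1 t.1.2 t.2 &&
    (~~ collinear t.1.1 t.1.2 t.2 &&
    [|| t.1.1.1 == t.1.2.1, t.1.2.1 == t.2.1 | t.2.1 == t.1.1.1])].

(** If two of the three linear coefficients agree, noncollinearity makes the
    third one different, so that exactly one of the three rotations of t has
    the agreeing pair in front. *)
Lemma mem_noncollinear_fiber_triples (F : finFieldType) (t : point_triple F) :
  (t \in noncollinear_fiber_triples F)%:R =
  (t \in fiber_triples F)%:R + (rotate t \in fiber_triples F)%:R
    + (rotate (rotate t) \in fiber_triples F)%:R :> int.
Proof.
case: t => -[u v] w; rewrite !inE /=.
rewrite (separated_triple_rotate u v w) -(separated_triple_rotate w u v).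
have [/and3P[_ /andP[_ uv] /and3P[_ uw vw]]|//] :=
  boolP (separated_triple u v w).
have {}uv := separated_neq uv; have {}vw := separated_neq vw.
have {uw} wu : w != u by rewrite eq_sym separated_neq.
have [uv1|uv1] := eqVneq u.1 v.1.
  rewrite collinear_fiber // uv1.
  by case: eqVneq.
have [vw1|vw1] := eqVneq v.1 w.1.
  by rewrite -collinear_rotate collinear_fiber // -vw1 (eq_sym v.1) (negPf uv1).
have [wu1|wu1] := eqVneq w.1 u.1.
  rewrite -2!collinear_rotate collinear_fiber //.
  by rewrite vw1.
by rewrite /= andbF.
Qed.

Lemma card_noncollinear_fiber_triples (F : finFieldType) : (2%:R : F) != 0 ->
  #|noncollinear_fiber_triples F|%:Z =
  3 * #|F|%:Z * (#|F|%:Z - 1)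
    * (#|F|%:Z ^+ 3 - 6 * #|F|%:Z ^+ 2 + 14 * #|F|%:Z - 13).
Proof.
move=> F2; have cE (A : {set point_triple F}) :
    #|A|%:Z = \sum_t (t \in A)%:R by rewrite sum_indicator cardZ_sum.
have rot_inj : injective (@rotate (F * F)) := can_inj (@rotateK _).
rewrite cE; under eq_bigr do rewrite mem_noncollinear_fiber_triples.
rewrite !big_split /= -(reindex_inj (inj_comp rot_inj rot_inj)
   (P := predT) (F := fun t => (t \in fiber_triples F)%:R)) /=.
rewrite -(reindex_inj rot_inj
   (P := predT) (F := fun t => (t \in fiber_triples F)%:R)) /=.
by rewrite -!cE card_fiber_triples //; ring.
Qed.

(** * From points to polynomials *)

Definition quad (F : finFieldType) (p : F * F) : {poly_3 F} :=
  npolyp 3 (Poly [:: p.2; p.1; 1]).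

Lemma polyseq_quad (F : finFieldType) (p : F * F) :
  quad p = [:: p.2; p.1; 1] :> seq F.
Proof.
by rewrite /quad npolypK ?size_Poly // (PolyK (c := 0)) //= oner_neq0.
Qed.

Lemma monic_quadratic_quad (F : finFieldType) (p : F * F) :
  monic_quadratic (quad p).
Proof.
by rewrite /monic_quadratic monicE lead_coefE polyseq_quad /= !eqxx.
Qed.

Lemma quad_coef (F : finFieldType) (u : {poly_3 F}) :
  monic_quadratic u -> quad (u`_1, u`_0) = u.
Proof.
case/andP=> /monicP + /eqP su; rewrite lead_coefE su => u2.
apply/npolyP => i; rewrite polyseq_quad.
case: i => [|[|[|i]]] //=; rewrite nth_nil nth_default ?su //.
Qed.

Lemma quad_inj (F : finFieldType) : injective (@quad F).
Proof.
move=> [a b] [c d] /(congr1 (fun u : {poly_3 F} => polyseq u)).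
by rewrite !polyseq_quad /= => -[-> ->].
Qed.

Lemma disc2_quad (F : finFieldType) (p : F * F) :
  (disc2 (quad p) != 0) = sqfree p.
Proof. by rewrite /disc2 polyseq_quad /= mulr1. Qed.

Lemma quad_neq0 (F : finFieldType) (p : F * F) : (quad p : {poly F}) != 0.
Proof. by rewrite -size_poly_eq0 polyseq_quad. Qed.

Lemma root_quad (F : finFieldType) (p : F * F) (x : F) :
  root (quad p) x = vanishes p x.
Proof.
rewrite /root /horner polyseq_quad /vanishes /=.
by congr (_ == 0); ring.
Qed.

(** A nontrivial common divisor of distinct monic quadratics divides their
    difference, which has degree at most one; it is therefore linear and
    provides a common root in the field. *)
Lemma resultant_quad (F : finFieldType) (u v : F * F) :
  (resultant (quad u) (quad v) != 0) = separated u v.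
Proof.
rewrite resultant_eq0 -leqNgt; apply/idP/idP => [g1|/andP[uv /forallP nuv]].
  have cop : coprimep (quad u) (quad v).
    by rewrite /coprimep eqn_leq g1 size_poly_gt0 gcdp_eq0 negb_and quad_neq0.
  apply/andP; split.
    by apply: contraTneq cop => ->; rewrite coprimepp polyseq_quad.
  apply/forallP => x; rewrite -!root_quad; apply/negP => /andP[ux vx].
  by have := coprimep_root cop ux; rewrite -[_ == 0]/(root _ _) vx.
set g := gcdp _ _; rewrite leqNgt; apply/negP => g1.
have gd : g %| (quad u : {poly F}) - (quad v : {poly F}).
  by rewrite dvdp_sub ?dvdp_gcdl ?dvdp_gcdr.
have sd : (size ((quad u : {poly F}) - (quad v : {poly F}))%R <= 2)%N.
  by apply/leq_sizeP => -[|[|[|j]]] // _; rewrite coefB !polyseq_quad /= subrr.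
have d0 : (quad u : {poly F}) - (quad v : {poly F}) != 0.
  rewrite subr_eq0; apply: contra uv => /eqP uv; apply/eqP/quad_inj.
  exact: val_inj.
have sg : size g = 2.
  by apply/eqP; rewrite eqn_leq g1 (leq_trans (dvdp_leq d0 gd) sd).
have [x gx] := poly2_root sg; case/negP: (nuv x).
by rewrite -!root_quad -root_gcd.
Qed.

Lemma quad_det_quad (F : finFieldType) (u v w : F * F) :
  (quad_det (quad u) (quad v) (quad w) == 0) = collinear u v w.
Proof.
rewrite /quad_det /collinear -[RHS]subr_eq0 -[RHS]oppr_eq0.
congr (_ == 0).
rewrite (expand_det_row _ ord0) !big_ord_recl big_ord0 /cofactor.
rewrite !(expand_det_row _ ord0) !big_ord_recl !big_ord0 /cofactor !det_mx11.
by rewrite !mxE /= !polyseq_quad /bump /=; ring.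
Qed.

Lemma mem_admissible_quad (F : finFieldType) (t : point_triple F) :
  (triple_of (@quad F) t \in admissible F)
    = separated_triple t.1.1 t.1.2 t.2.
Proof.
case: t => -[u v] w; rewrite inE /= !monic_quadratic_quad /= !mulf_eq0 !negb_or.
rewrite !disc2_quad !resultant_quad (separatedC w u) /separated_triple.
by case: (sqfree u); case: (sqfree v); case: (sqfree w); rewrite ?andbF //=;
   case: separated; case: separated; case: separated.
Qed.

(** Every admissible triple consists of monic quadratics, so the sets of triples
    can be counted on coefficients. *)
Lemma card_quad_triples (F : finFieldType) (A : {set quad_triple F})
    (B : {set point_triple F}) :
  A \subset admissible F ->
  (forall t, (triple_of (@quad F) t \in A) = (t \in B)) -> #|A| = #|B|.
Proof.
move=> /subsetP Aadm AB; rewrite -(card_imset (f := triple_of (@quad F)) B).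
  congr #|pred_of_set _|; apply/setP => -[[u v] w].
  apply/idP/imsetP => [Auvw|[t Bt ->]]; last by rewrite AB.
  have := Aadm _ Auvw; rewrite inE => /and4P[mu mv mw _].
  exists ((u : {poly F})`_1, (u : {poly F})`_0,
          ((v : {poly F})`_1, (v : {poly F})`_0),
          ((w : {poly F})`_1, (w : {poly F})`_0)).
    by rewrite -AB /triple_of /= !quad_coef.
  by rewrite /triple_of /= !quad_coef.
by move=> [[u v] w] [[u' v'] w'] [] /quad_inj -> /quad_inj -> /quad_inj ->.
Qed.

(** * The cardinals *)

Theorem theorem6p4 (F : finFieldType) (q : nat)
    (card_F : #|F| = q) (q_odd : odd q) (q_ge3 : (3 <= q)%N) :
  [/\ #|admissible F|%:Z =
        q%:Z * (q%:Z - 1) * (q%:Z - 2) ^+ 2 * (q%:Z ^+ 2 - q%:Z + 4),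
      #|stratumD F|%:Z =
        q%:Z * (q%:Z - 1) * (q%:Z - 2) * (q%:Z ^+ 2 - 3 * q%:Z + 3),
      #|stratumG5 F|%:Z =
        3 * q%:Z * (q%:Z - 1) *
        (q%:Z ^+ 3 - 6 * q%:Z ^+ 2 + 14 * q%:Z - 13),
      #|stratumG6 F|%:Z =
        #|admissible F|%:Z - #|stratumD F|%:Z - #|stratumG5 F|%:Z &
      #|stratumG6 F|%:Z =
        q%:Z * (q%:Z - 1) *
        (q%:Z ^+ 4 - 9 * q%:Z ^+ 3 + 35 * q%:Z ^+ 2 - 71 * q%:Z + 61)].
Proof.
have F2 : (2%:R : F) != 0 by apply: odd_card_neq0; rewrite card_F.
have sD : stratumD F \subset admissible F.
  by apply/subsetP => t; rewrite inE => /andP[].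
have s5 : stratumG5 F \subset admissible F.
  by apply/subsetP => t; rewrite inE => /andP[].
have cA := card_admissible_triples F2.
rewrite -(card_quad_triples (A := admissible F)) // in cA; last first.
  by move=> t; rewrite mem_admissible_quad inE.
have cD := count_collinear F2.
rewrite -(card_quad_triples (A := stratumD F)) // in cD; last first.
  by move=> t; rewrite !inE -quad_det_quad -mem_admissible_quad inE.
have c5 := card_noncollinear_fiber_triples F2.
rewrite -(card_quad_triples (A := stratumG5 F)) // in c5; last first.
  move=> t; rewrite !inE -quad_det_quad -mem_admissible_quad inE.
  by rewrite /= !polyseq_quad.
have c6 : #|stratumG6 F|%:Z =
    #|admissible F|%:Z - #|stratumD F|%:Z - #|stratumG5 F|%:Z.
  rewrite -(cardsID (stratumD F :|: stratumG5 F) (admissible F)).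
  rewrite (setIidPr _) ?subUset ?sD // cardsU disjoint_setI0 ?cards0 ?subn0.
    by rewrite !PoszD; ring.
  rewrite -setI_eq0; apply/eqP/setP => -[[u v] w]; rewrite !inE.
  by case: (quad_det u v w == 0); rewrite ?andbF.
by split=> //; rewrite ?c6 ?cA ?cD ?c5 card_F; ring.
Qed.
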